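(* There exists a positive constant $C$ such that for all $n,p\in\mathbb N$, unitary matrices $U_1\in\mathbb C^{p\times p}$, $U_2\in\mathbb C^{n\times n}$ and $A\in\mathbb R^{p\times n}$ with nonnegative entries such that $A^*A$ and $AA^*$ are irreducible and $\|A^*A\|_2\in(0,1]$, the following bound holds: $$\left\|\begin{pmatrix} U_1 & A \\ A^* & U_2 \end{pmatrix}^{-1}\right\|_2\le\frac{C}{\mathrm{Gap}(AA^* )\,\big|1-\|A^*A\|_2\langle v_1,U_1v_1\rangle\langle v_2,U_2v_2\rangle\big|},$$ where $v_1\in\mathbb C^p$ and $v_2\in\mathbb C^n$ are the unique positive, normalized eigenvectors with $AA^*v_1=\|A^*A\|_2v_1$ and $A^*Av_2=\|A^*A\|_2v_2$. The norm on the left hand side is infinite if and only if the right hand side is infinite, i.e., in this case the inverse does not exist.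
   Context: For $v,w\in\mathbb C^l$, the scalar product is $\langle v,w\rangle=l^{-1}\sum_{i=1}^l\overline{v_i}w_i$ and the norm is given by $\|w\|_2^2=l^{-1}\sum_{i=1}^l|w_i|^2$; normalized means $\|v\|_2=1$. For a square matrix, $\|\cdot\|_2$ denotes the operator norm induced by the vector norm $\|\cdot\|_2$ ($2\to2$ norm). For a compact self-adjoint operator $T$ on a Hilbert space, the spectral gap $\mathrm{Gap}(T)\ge0$ is the difference between the two largest eigenvalues of $|T|$ (defined by spectral calculus); if the operator norm $\|T\|$ is a degenerate eigenvalue of $|T|$, then $\mathrm{Gap}(T)=0$. By this definition, if $AA^*$ is irreducible then $\mathrm{Gap}(AA^* )=\|AA^*\|_2-\max(\sigma(AA^* )\setminus\{\|AA^*\|_2\})$, where $\sigma(AA^* )$ denotes the spectrum of $AA^*$. *)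

(* Defs.v *)
From mathcomp Require Import all_boot all_order all_algebra.
From mathcomp Require Import spectral complex.
From mathcomp Require Import boolp classical_sets reals constructive_ereal.

Set Implicit Arguments.
Unset Strict Implicit.
Unset Printing Implicit Defensive.

Import Order.TTheory GRing.Theory Num.Theory.
Local Open Scope ring_scope.
Local Open Scope complex_scope.
Local Open Scope sesquilinear_scope.

Section Defs.
Variable R : realType.

(* The complex modulus as an element of R (`|z| itself lives in R[i]). *)
Definition cmod (z : R[i]) : R := complex.Re `|z|.

Definition inner l (v w : 'cV[R[i]]_l) : R[i] :=
  l%:R^-1 * \sum_(i < l) (v i ord0)^* * w i ord0.

Definition vnorm l (w : 'cV[R[i]]_l) : R :=
  Num.sqrt (l%:R^-1 * \sum_(i < l) cmod (w i ord0) ^+ 2).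

Definition opnorm l (T : 'M[R[i]]_l) : R :=
  sup [set vnorm (T *m v) | v in [set v : 'cV[R[i]]_l | vnorm v <= 1]]%classic.

(* The norm of T^-1, infinite when T has no inverse; it is compared with bounds
   in \bar R, where r%:E^-1 is +oo for r = 0. *)
Definition inv_opnorm l (T : 'M[R[i]]_l) : \bar R :=
  if T \in unitmx then (opnorm (invmx T))%:E else +oo%E.

(* No nontrivial set of indices is decoupled from its complement, i.e. no
   permutation of the indices makes T block triangular. *)
Definition irreducible_mx l (T : 'M[R[i]]_l) : Prop :=
  forall I : {set 'I_l}, I != finset.set0 -> I != finset.setT ->
    exists i j, [/\ i \in I, j \notin I & T i j != 0].

(* |T| by spectral calculus, for T normal: T is
   invmx (spectralmx T) *m diag_mx (spectral_diag T) *m spectralmx T. *)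
Definition absmx l (T : 'M[R[i]]_l) : 'M[R[i]]_l :=
  invmx (spectralmx T) *m diag_mx (map_mx Num.norm (spectral_diag T))
    *m spectralmx T.

(* The eigenvalues of |T|, with multiplicity, in decreasing order. *)
Definition abs_eigenvalues l (T : 'M[R[i]]_l) : seq R :=
  sort (fun x y => y <= x)
    [seq complex.Re (spectral_diag (absmx T) ord0 i) | i <- enum 'I_l].

(* Meant for T self-adjoint.  A degenerate top eigenvalue is listed twice, so
   the gap is then 0.  In dimension one the missing second eigenvalue is read
   as 0 (the default of _`_1), so that Gap T is the norm of T. *)
Definition Gap l (T : 'M[R[i]]_l) : R :=
  (abs_eigenvalues T)`_0 - (abs_eigenvalues T)`_1.

(* 0 < z in R[i] says that z is real and positive. *)
Definition pos_normalized_eigenvector l (T : 'M[R[i]]_l) (a : R)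
    (v : 'cV[R[i]]_l) : Prop :=
  [/\ forall i, 0 < v i ord0, vnorm v = 1 & T *m v = a%:C *: v].

End Defs.

(* Main.v *)
Require Import Defs.
From mathcomp Require Import all_boot all_order all_algebra.
From mathcomp Require Import spectral complex.
From mathcomp Require Import boolp classical_sets reals constructive_ereal.
From mathcomp Require Import ring lra.
Set Implicit Arguments.
Unset Strict Implicit.
Unset Printing Implicit Defensive.
Import Order.TTheory GRing.Theory Num.Theory.
Local Open Scope ring_scope.
Local Open Scope complex_scope.
Local Open Scope sesquilinear_scope.

(** Let s be the square root of the norm of A^* A, so that s is the largest
    singular value of A, and let a, b be the Euclidean-normalized positive
    singular vectors, A b = s a and A^* a = s b.  Perron-Frobenius for A A^* and
    A^* A ([eigen_simple], [top_pair]) gives their existence and uniqueness and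
    makes the gap g of A A^* positive; on the complements of a and b the squared
    norms of A^* and A are at most s^2 - g.

    The bound is a lower bound for the block matrix M, proved directly on a
    vector (x, y) with image (f, h), |(f, h)| = e and |(x, y)| = N
    ([block_lower_bound]).  Put u1 = <a, U1 a>, u2 = <b, U2 b>,
    d = |1 - s^2 u1 u2|, and split x = xi a + x', y = eta b + y' orthogonally.

    - Energy: U1 x = f - A y gives |x| <= |f| + |A y|, where
      |A y|^2 <= |y|^2 - g |y'|^2 since s <= 1.  The second block row gives the
      mirror inequality, and in the sum of the two squares |x|^2 + |y|^2 cancels,
      leaving g (|x'|^2 + |y'|^2) <= 6 e N whenever e <= N.
    - Projection: pairing the first row with U1 a gives
      xi + s eta u1^* = <U1 a, f> - <U1 a - u1 a, A y'>, because A y' is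
      orthogonal to a.  The vector U1 a - u1 a has squared norm
      1 - |u1|^2 <= 2 d.  Together with the mirror identity,
      |xi| d and |eta| d are both at most 2 e + sqrt (2 d) (|x'| + |y'|).

    The energy estimate alone controls x' and y' by sqrt (e N / g) only, and the
    factor sqrt d in the projection estimate is what compensates for this: the
    two combine to g d N <= 384 e ([defect_estimate]).

    Conversely, as g > 0, the right-hand side is infinite only if d = 0.  Since
    s, |u1|, |u2| <= 1, this forces s = |u1| = |u2| = 1, hence U1 a = u1 a,
    U2 b = u2 b and u1 u2 = 1, and (a, - u1 b) is in the kernel of M
    ([block_singular]). *)

(** * Moduli, scalar products and Euclidean norms *)

Section Hermitian.
Variable R : realType.
Implicit Types z : R[i].

Lemma cmodE z : (cmod z)%:C = `|z|.
Proof. by rewrite /cmod normc_def. Qed.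

Lemma cmod_ge0 z : 0 <= cmod z.
Proof. by rewrite -ler0c cmodE. Qed.

Lemma cmodM z1 z2 : cmod (z1 * z2) = cmod z1 * cmod z2.
Proof. by apply: complexI; rewrite rmorphM /= !cmodE normrM. Qed.

Lemma cmodN z : cmod (- z) = cmod z.
Proof. by rewrite /cmod normrN. Qed.

Lemma cmodD z1 z2 : cmod (z1 + z2) <= cmod z1 + cmod z2.
Proof. by rewrite -lecR rmorphD /= !cmodE ler_normD. Qed.

Lemma cmodB z1 z2 : cmod (z1 - z2) <= cmod z1 + cmod z2.
Proof. by rewrite -[cmod z2]cmodN cmodD. Qed.

Lemma cmod_conj z : cmod (z^*)%R = cmod z.
Proof. by rewrite /cmod norm_conjC. Qed.

Lemma cmod_eq0 z : (cmod z == 0) = (z == 0).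
Proof. by rewrite -(inj_eq (@complexI R)) cmodE normr_eq0. Qed.

Lemma cmod_real (x : R) : 0 <= x -> cmod x%:C = x.
Proof. by move=> x0; apply: complexI; rewrite cmodE ger0_norm // ler0c. Qed.

Lemma cmod1 : cmod (1 : R[i]) = 1.
Proof. by rewrite /cmod normr1. Qed.

Lemma cmod0 : cmod (0 : R[i]) = 0.
Proof. by rewrite /cmod normr0. Qed.

Lemma cmod_id z : 0 <= z -> (cmod z)%:C = z.
Proof. by move=> z0; rewrite cmodE ger0_norm. Qed.

Lemma sqr_cmod z : (cmod z ^+ 2)%:C = (z^*)%R * z.
Proof. by rewrite rmorphXn /= cmodE normCK mulrC. Qed.

Lemma cmod_sum n (F : 'I_n -> R[i]) :
  cmod (\sum_i F i) <= \sum_i cmod (F i).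
Proof.
rewrite -lecR cmodE rmorph_sum /= (eq_bigr _ (fun i _ => cmodE (F i))).
exact: ler_norm_sum.
Qed.

Lemma conj_real (x : R) : ((x%:C)^*)%R = x%:C.
Proof. by apply: conj_Creal; apply/complex_realP; exists x. Qed.

(** No dimension-dependent factor here, so that the conjugate transpose of a
    rectangular matrix is its adjoint and norms of block vectors add up. *)
Definition dot l (v w : 'cV[R[i]]_l) : R[i] := (v ^t* *m w) ord0 ord0.

Definition sqn l (w : 'cV[R[i]]_l) : R := \sum_i cmod (w i ord0) ^+ 2.

Definition nrm l (w : 'cV[R[i]]_l) : R := Num.sqrt (sqn w).

Section Dot.
Variable l : nat.
Implicit Types v w a : 'cV[R[i]]_l.

Lemma dotE v w : dot v w = \sum_i ((v i ord0)^*)%R * w i ord0.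
Proof. by rewrite /dot mxE; apply: eq_bigr => i _; rewrite !mxE. Qed.

Lemma dot_conj v w : ((dot v w)^*)%R = dot w v.
Proof.
rewrite !dotE rmorph_sum; apply: eq_bigr => i _.
by rewrite rmorphM /= conjCK mulrC.
Qed.

Lemma dotDr v w1 w2 : dot v (w1 + w2) = dot v w1 + dot v w2.
Proof. by rewrite /dot mulmxDr mxE. Qed.

Lemma dotZr c v w : dot v (c *: w) = c * dot v w.
Proof. by rewrite /dot -scalemxAr mxE. Qed.

Lemma dotNr v w : dot v (- w) = - dot v w.
Proof. by rewrite /dot mulmxN mxE. Qed.

Lemma dotDl w v1 v2 : dot (v1 + v2) w = dot v1 w + dot v2 w.
Proof. by rewrite -dot_conj dotDr rmorphD /= !dot_conj. Qed.

Lemma dotZl c v w : dot (c *: v) w = (c^*)%R * dot v w.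
Proof. by rewrite -dot_conj dotZr rmorphM /= dot_conj. Qed.

Lemma dotNl v w : dot (- v) w = - dot v w.
Proof. by rewrite -dot_conj dotNr rmorphN /= dot_conj. Qed.

Lemma sqnE w : (sqn w)%:C = dot w w.
Proof.
rewrite dotE rmorph_sum; apply: eq_bigr => i _; exact: sqr_cmod.
Qed.

Lemma sqn_ge0 w : 0 <= sqn w.
Proof. by apply: sumr_ge0 => i _; apply: sqr_ge0. Qed.

Lemma nrm_ge0 w : 0 <= nrm w.
Proof. exact: sqrtr_ge0. Qed.

Lemma sqr_nrm w : nrm w ^+ 2 = sqn w.
Proof. by rewrite sqr_sqrtr // sqn_ge0. Qed.

Lemma sqn0 : sqn (0 : 'cV[R[i]]_l) = 0.
Proof.
by rewrite /sqn big1 // => i _; rewrite mxE cmod0 expr0n.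
Qed.

Lemma sqn_eq0 w : (sqn w == 0) = (w == 0).
Proof.
apply/eqP/eqP => [w0|->]; last exact: sqn0.
apply/matrixP => i j; rewrite ord1 mxE; apply/eqP.
rewrite -cmod_eq0 -sqrf_eq0; apply/eqP.
by apply: (psumr_eq0P _ w0) => // k _; apply: sqr_ge0.
Qed.

Lemma nrm_eq0 w : (nrm w == 0) = (w == 0).
Proof. by rewrite -sqn_eq0 -sqr_nrm sqrf_eq0. Qed.

Lemma sqnZ c w : sqn (c *: w) = cmod c ^+ 2 * sqn w.
Proof.
by rewrite /sqn mulr_sumr; apply: eq_bigr => i _; rewrite mxE cmodM exprMn.
Qed.

Lemma nrmZ c w : nrm (c *: w) = cmod c * nrm w.
Proof. by rewrite /nrm sqnZ sqrtrM ?sqr_ge0// sqrtr_sqr ger0_norm ?cmod_ge0. Qed.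

Lemma nrmN w : nrm (- w) = nrm w.
Proof. by rewrite -scaleN1r nrmZ cmodN cmod1 mul1r. Qed.

Lemma sqnD v w : dot v w = 0 -> sqn (v + w) = sqn v + sqn w.
Proof.
move=> vw; apply: complexI; rewrite rmorphD /= !sqnE dotDr !dotDl vw.
by rewrite -(dot_conj v w) vw rmorph0 addr0 add0r.
Qed.

Lemma dot_residual a w : dot a a = 1 -> dot a (w - dot a w *: a) = 0.
Proof. by move=> aa; rewrite dotDr dotNr dotZr aa mulr1 subrr. Qed.

Lemma sqn_split a w : dot a a = 1 ->
  sqn w = cmod (dot a w) ^+ 2 + sqn (w - dot a w *: a).
Proof.
move=> aa; have a1 : sqn a = 1 by apply: complexI; rewrite sqnE aa.
rewrite -{1}(subrKC (dot a w *: a) w) [LHS]sqnD; first by rewrite sqnZ a1 mulr1.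
by rewrite dotZl dot_residual // mulr0.
Qed.

Lemma sqn_unit a : dot a a = 1 -> sqn a = 1.
Proof. by move=> aa; apply: complexI; rewrite sqnE aa. Qed.

Lemma nrm_unit a : dot a a = 1 -> nrm a = 1.
Proof. by move=> aa; rewrite /nrm sqn_unit // sqrtr1. Qed.

Lemma CauchySchwarz_unit a w : dot a a = 1 -> cmod (dot a w) <= nrm w.
Proof.
move=> aa; rewrite -(@ler_pXn2r _ 2) ?nnegrE ?cmod_ge0 ?nrm_ge0//.
by rewrite sqr_nrm (sqn_split w aa) lerDl sqn_ge0.
Qed.

Lemma dot_normalize v : v != 0 ->
  dot ((nrm v)^-1%:C *: v) ((nrm v)^-1%:C *: v) = 1.
Proof.
move=> v0; rewrite -sqnE -sqr_nrm nrmZ cmod_real ?invr_ge0 ?nrm_ge0 //.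
by rewrite mulVf ?nrm_eq0 // expr1n.
Qed.

Lemma CauchySchwarz v w : cmod (dot v w) <= nrm v * nrm w.
Proof.
have [->|v0] := eqVneq v 0.
  by rewrite -dot_conj cmod_conj /dot mulmx0 mxE cmod0 mulr_ge0 ?nrm_ge0.
have := CauchySchwarz_unit w (dot_normalize v0).
rewrite dotZl cmodM cmod_conj cmod_real ?invr_ge0 ?nrm_ge0 //.
by rewrite ler_pdivrMl // lt_def nrm_eq0 v0 nrm_ge0.
Qed.

Lemma nrmD v w : nrm (v + w) <= nrm v + nrm w.
Proof.
rewrite -(@ler_pXn2r _ 2) ?nnegrE ?addr_ge0 ?nrm_ge0//.
rewrite sqr_nrm -(cmod_real (sqn_ge0 _)) sqnE dotDr !dotDl.
have -> : (nrm v + nrm w) ^+ 2 =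
    nrm v * nrm v + nrm w * nrm v + (nrm v * nrm w + nrm w * nrm w) by ring.
by apply: le_trans (cmodD _ _) _; apply: lerD;
  apply: le_trans (cmodD _ _) _; apply: lerD; apply: CauchySchwarz.
Qed.

End Dot.

Lemma dot_adj m n (T : 'M[R[i]]_(m, n)) v w : dot v (T *m w) = dot (T ^t* *m v) w.
Proof. by rewrite /dot trmx_mul map_mxM trmxCK mulmxA. Qed.

Lemma mulmx_ge0 m k l (F : 'M[R[i]]_(m, k)) (G : 'M[R[i]]_(k, l)) :
  (forall i j, 0 <= F i j) -> (forall i j, 0 <= G i j) -> forall i j, 0 <= (F *m G) i j.
Proof. by move=> F0 G0 i j; rewrite mxE sumr_ge0 // => k' _; rewrite mulr_ge0. Qed.

Lemma dot_unitary n (U : 'M[R[i]]_n) v w :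
  U \is unitarymx -> dot (U *m v) (U *m w) = dot v w.
Proof.
rewrite -trmxC_unitary => /unitarymxP; rewrite trmxCK => UU.
by rewrite dot_adj mulmxA UU mul1mx.
Qed.

Lemma sqn_unitary n (U : 'M[R[i]]_n) w : U \is unitarymx -> sqn (U *m w) = sqn w.
Proof. by move=> Uu; apply: complexI; rewrite !sqnE dot_unitary. Qed.

Lemma nrm_unitary n (U : 'M[R[i]]_n) w : U \is unitarymx -> nrm (U *m w) = nrm w.
Proof. by move=> Uu; rewrite /nrm sqn_unitary. Qed.

Lemma sqn_col_mx m n (x : 'cV[R[i]]_m) (y : 'cV[R[i]]_n) :
  sqn (col_mx x y) = sqn x + sqn y.
Proof.
rewrite /sqn big_split_ord /=; congr (_ + _); apply: eq_bigr => i _.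
  by rewrite col_mxEu.
by rewrite col_mxEd.
Qed.

End Hermitian.

(** * The lower bound for the block matrix *)

(** The real-number core of the bound.  X, Y, X', Y' are the norms of x, y, x',
    y', while P and Q stand for |A y| and |A^* x|, F and H for the norms of the
    two blocks of the image, and r for sqrt (2 d).  If e is at least
    a fixed fraction of N, of g N or of d N the claim is immediate.  Otherwise the energy
    inequality gives X'^2 + Y'^2 <= N^2 / 2, so xi or eta is at least N / 2, and
    then the term 2 e in the projection inequality is absorbed:
    d N <= 4 r (X' + Y').  Squaring, with r^2 <= 2 d and the energy inequality
    again, makes one factor d N cancel. *)
Lemma defect_estimate (R : rcfType) (g d e N X Y X' Y' xi eta P Q F H r : R) :
  0 < g <= 1 -> 0 <= d <= 2 -> 0 <= N -> 0 <= X -> 0 <= Y -> 0 <= X' -> 0 <= Y' ->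
  0 <= xi -> 0 <= eta -> 0 <= P -> 0 <= Q -> 0 <= F <= e -> 0 <= H <= e -> 0 <= r ->
  X ^+ 2 = xi ^+ 2 + X' ^+ 2 -> Y ^+ 2 = eta ^+ 2 + Y' ^+ 2 ->
  N ^+ 2 = X ^+ 2 + Y ^+ 2 ->
  P ^+ 2 <= Y ^+ 2 - g * Y' ^+ 2 -> Q ^+ 2 <= X ^+ 2 - g * X' ^+ 2 ->
  X <= F + P -> Y <= H + Q ->
  r ^+ 2 <= 2 * d ->
  xi * d <= 2 * e + r * (X' + Y') -> eta * d <= 2 * e + r * (X' + Y') ->
  g * d * N <= 384 * e.
Proof.
move=> /andP[g0 g1] /andP[d0 d2] N0 X0 Y0 X'0 Y'0 xi0 eta0 P0 Q0.
move=> /andP[F0 Fe] /andP[H0 He] r0 defX defY defN Ple Qle XP YQ r2 xid etad.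
have e0 : 0 <= e by lra.
have gd0 : 0 <= g * d by rewrite mulr_ge0 // ltW.
have gd2 : g * d <= 2 by have := ler_wpM2r d0 g1; lra.
have [Ne|eN] := leP N e.
  have : g * d * N <= 2 * N by apply: ler_wpM2r.
  lra.
have sqle u v : 0 <= u -> 0 <= v -> u ^+ 2 <= v ^+ 2 -> u <= v.
  by move=> u0 v0; rewrite ler_pXn2r.
have PN : P <= N.
  by apply: sqle => //; have := mulr_ge0 (ltW g0) (sqr_ge0 Y'); have := sqr_ge0 X; lra.
have QN : Q <= N.
  by apply: sqle => //; have := mulr_ge0 (ltW g0) (sqr_ge0 X'); have := sqr_ge0 Y; lra.
(* The two squared inequalities are added so that X^2 + Y^2 cancels. *)
have energy : g * (X' ^+ 2 + Y' ^+ 2) <= 6 * (e * N).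
  have X2 : X ^+ 2 <= P ^+ 2 + 3 * (e * N).
    have : X ^+ 2 <= (F + P) ^+ 2 by rewrite ler_pXn2r ?nnegrE ?addr_ge0.
    have : (F + P) ^+ 2 <= (e + P) ^+ 2 by rewrite ler_pXn2r ?nnegrE ?addr_ge0 // lerD2r.
    have : e * P <= e * N by apply: ler_wpM2l.
    have : e * e <= e * N by apply: ler_wpM2l => //; apply: ltW.
    rewrite !expr2; lra.
  have Y2 : Y ^+ 2 <= Q ^+ 2 + 3 * (e * N).
    have : Y ^+ 2 <= (H + Q) ^+ 2 by rewrite ler_pXn2r ?nnegrE ?addr_ge0.
    have : (H + Q) ^+ 2 <= (e + Q) ^+ 2 by rewrite ler_pXn2r ?nnegrE ?addr_ge0 // lerD2r.
    have : e * Q <= e * N by apply: ler_wpM2l.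
    have : e * e <= e * N by apply: ler_wpM2l => //; apply: ltW.
    rewrite !expr2; lra.
  lra.
have [gN|Ng] := leP (g * N) (12 * e).
  have : d * (g * N) <= 2 * (g * N) by apply: ler_wpM2r => //; apply: mulr_ge0 => //; apply: ltW.
  rewrite mulrA (mulrC d); lra.
have [dN|Nd] := leP (d * N) (8 * e).
  have : g * (d * N) <= 1 * (d * N) by apply: ler_wpM2r => //; apply: mulr_ge0.
  rewrite mulrA; lra.
have N_gt0 : 0 < N by lra.
have half : X' ^+ 2 + Y' ^+ 2 <= N ^+ 2 / 2.
  rewrite -(ler_pM2l g0); apply: (le_trans energy).
  have : 12 * e * N <= g * N * N by apply: ler_wpM2r => //; apply: ltW.
  rewrite expr2; lra.
set S := X' + Y' in xid etad *.
have S0 : 0 <= S by apply: addr_ge0.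
have S2 : S ^+ 2 <= 2 * (X' ^+ 2 + Y' ^+ 2).
  have := sqr_ge0 (X' - Y'); rewrite /S !expr2; lra.
(* At least one of xi, eta carries half of the mass of the vector. *)
have big : d * N <= 4 * (r * S).
  have xieta : N <= 2 * xi \/ N <= 2 * eta.
    have [?|xiN] := leP N (2 * xi); [by left|right].
    apply: sqle; [by []|lra|].
    have : (2 * xi) ^+ 2 <= N ^+ 2 by rewrite ler_pXn2r ?nnegrE // ?(ltW xiN) //; lra.
    rewrite !exprMn; lra.
  case: xieta => h.
    have : N * d <= 2 * xi * d by apply: ler_wpM2r.
    lra.
  have : N * d <= 2 * eta * d by apply: ler_wpM2r.
  lra.
have big2 : (d * N) ^+ 2 <= 16 * (2 * d * S ^+ 2).
  have : (d * N) ^+ 2 <= (4 * (r * S)) ^+ 2.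
    by rewrite ler_pXn2r ?nnegrE ?mulr_ge0.
  have : r ^+ 2 * S ^+ 2 <= 2 * d * S ^+ 2 by apply: ler_wpM2r => //; apply: sqr_ge0.
  rewrite !exprMn; lra.
have dN0 : 0 < d * N by lra.
rewrite -(ler_pM2l dN0).
have : g * (d * N) ^+ 2 <= g * (16 * (2 * d * S ^+ 2)) by rewrite ler_pM2l.
have : d * (g * S ^+ 2) <= d * (12 * (e * N)).
  apply: ler_wpM2l => //.
  have : g * S ^+ 2 <= g * (2 * (X' ^+ 2 + Y' ^+ 2)) by rewrite ler_pM2l.
  lra.
rewrite (expr2 (d * N)); lra.
Qed.


Section UnitaryOverlap.
Variables (R : realType) (m : nat) (U : 'M[R[i]]_m) (v : 'cV[R[i]]_m).
Hypotheses (Uu : U \is unitarymx) (vv : dot v v = 1).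

Let u := dot v (U *m v).

Lemma cmod_overlap_le1 : cmod u <= 1.
Proof. by rewrite -(nrm_unit vv) -(nrm_unitary v Uu) CauchySchwarz_unit. Qed.

Lemma sqn_overlap_defect : sqn (U *m v - u *: v) = 1 - cmod u ^+ 2.
Proof.
have := sqn_split (U *m v) vv; rewrite sqn_unitary // (sqn_unit vv) -/u => ->.
by rewrite [RHS]addrAC subrr add0r.
Qed.

(** Equality in Cauchy-Schwarz: an overlap of modulus one leaves no defect. *)
Lemma overlap1_eigenvector : cmod u = 1 -> U *m v = u *: v.
Proof.
move=> u1; apply/eqP; rewrite -subr_eq0 -sqn_eq0 sqn_overlap_defect.
by rewrite u1 expr1n subrr.
Qed.

End UnitaryOverlap.

(** The two block rows of the system are mirror images under the exchange of
    (U1, A, a) with (U2, A^*, b); this section treats one row. *)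
Section HalfSystem.
Variables (R : realType) (p n : nat) (U : 'M[R[i]]_p) (A : 'M[R[i]]_(p, n)).
Variables (a : 'cV[R[i]]_p) (b : 'cV[R[i]]_n) (s : R).
Hypotheses (Uu : U \is unitarymx) (aa : dot a a = 1) (bb : dot b b = 1).
Hypotheses (Ab : A *m b = s%:C *: a) (Aa : A ^t* *m a = s%:C *: b).

Lemma dot_mul_perp z : dot b z = 0 -> dot a (A *m z) = 0.
Proof. by move=> bz; rewrite dot_adj Aa dotZl bz mulr0. Qed.

Lemma mul_split y : A *m y = (s%:C * dot b y) *: a + A *m (y - dot b y *: b).
Proof. by rewrite mulmxBr -scalemxAr Ab scalerA mulrC subrKC. Qed.

(** The component of y along b is not stretched because s <= 1, and the image of
    the orthogonal component stays orthogonal to a, so the squared norms add. *)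
Lemma sqn_mul_gap g y : 0 <= s <= 1 ->
  (forall z, dot b z = 0 -> sqn (A *m z) <= (s ^+ 2 - g) * sqn z) ->
  sqn (A *m y) <= sqn y - g * sqn (y - dot b y *: b).
Proof.
case/andP=> s0 s1 gap.
have by' : dot b (y - dot b y *: b) = 0 by apply: dot_residual.
rewrite {1}mul_split sqnD; last by rewrite dotZl dot_mul_perp // mulr0.
rewrite sqnZ (sqn_unit aa) mulr1 cmodM (cmod_real s0) exprMn (sqn_split y bb).
have s2 : s ^+ 2 <= 1 by rewrite expr_le1.
have c0 := sqr_ge0 (cmod (dot b y)); have y0 := sqn_ge0 (y - dot b y *: b).
have := ler_wpM2r c0 s2; have := ler_wpM2r y0 s2; have := gap _ by'.
move: (sqn _) (sqn _) (cmod _ ^+ 2) (s ^+ 2) => *; lra.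
Qed.

(** Pairing the row with U a keeps the component of x along a; against A y' the
    vector U a may be replaced by its defect U a - u a, as A y' is orthogonal
    to a.  The defect is small when the overlap u is close to the unit circle. *)
Lemma cmod_half_system x y :
  cmod (dot a x + s%:C * dot b y * ((dot a (U *m a))^*)%R) <=
    nrm (U *m x + A *m y) +
    Num.sqrt (1 - cmod (dot a (U *m a)) ^+ 2) * nrm (A *m (y - dot b y *: b)).
Proof.
set u := dot a (U *m a); set y' := y - dot b y *: b.
have -> : dot a x + s%:C * dot b y * (u^*)%R =
    dot (U *m a) (U *m x + A *m y) - dot (U *m a - u *: a) (A *m y').
  rewrite dotDr dot_unitary // {1}mul_split -/y' dotDr dotZr dotDl dotNl dotZl.
  by rewrite dot_mul_perp ?dot_residual // /u dot_conj; ring.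
apply: le_trans (cmodB _ _) _; apply: lerD.
  by rewrite -[leRHS]mul1r -(nrm_unit aa) -(nrm_unitary a Uu) CauchySchwarz.
by rewrite -(sqn_overlap_defect Uu aa) CauchySchwarz.
Qed.

Lemma nrm_half_system x y : nrm x <= nrm (U *m x + A *m y) + nrm (A *m y).
Proof.
rewrite -(nrm_unitary x Uu) -(nrmN (A *m y)); apply: le_trans (nrmD _ _).
by rewrite addrK.
Qed.

End HalfSystem.

Section Adjoint.
Variables (R : realType) (p n : nat) (A : 'M[R[i]]_(p, n)).

(** A matrix and its adjoint have the same norm between corresponding
    subspaces: |A z|^2 = <z, A^* A z> <= |z| |A^* A z|. *)
Lemma sqn_mul_adj K z : 0 <= K ->
  sqn (A ^t* *m (A *m z)) <= K * sqn (A *m z) -> sqn (A *m z) <= K * sqn z.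
Proof.
move=> K0 h2; set q := A *m z in h2 *.
have h : sqn q <= nrm z * nrm (A ^t* *m q).
  rewrite -(cmod_real (sqn_ge0 q)) sqnE {2}/q dot_adj -dot_conj cmod_conj.
  exact: CauchySchwarz.
have [q0|q0] := eqVneq (sqn q) 0; first by rewrite q0 mulr_ge0 ?sqn_ge0.
have qp : 0 < sqn q by rewrite lt_def q0 sqn_ge0.
rewrite -(ler_pM2r qp).
have : sqn q ^+ 2 <= (nrm z * nrm (A ^t* *m q)) ^+ 2.
  by rewrite ler_pXn2r ?nnegrE ?mulr_ge0 ?nrm_ge0 ?sqn_ge0.
rewrite exprMn !sqr_nrm expr2 => /le_trans; apply.
by rewrite [leRHS]mulrAC mulrC ler_wpM2r ?sqn_ge0.
Qed.

End Adjoint.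

(** With t = s^2, x = |u1|, y = |u2|: an overlap x well inside the unit disc keeps
    d away from zero, so the defect 1 - x^2 is itself bounded by d. *)
Lemma overlap_defect_le (R : realFieldType) (t x y d : R) :
  0 <= t <= 1 -> 0 <= x <= 1 -> 0 <= y <= 1 -> 1 - t * x * y <= d ->
  1 - x ^+ 2 <= 2 * d.
Proof.
move=> /andP[t0 t1] /andP[x0 x1] /andP[y0 y1] dge.
have : t * x * y <= x by rewrite mulrAC ler_piMl // mulr_ile1.
nra.
Qed.

Lemma overlaps_eq1 (R : realFieldType) (s x y : R) :
  0 <= s <= 1 -> 0 <= x <= 1 -> 0 <= y <= 1 -> 1 <= s ^+ 2 * x * y ->
  [/\ s = 1, x = 1 & y = 1].
Proof.
move=> /andP[s0 s1] /andP[x0 x1] /andP[y0 y1] h.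
have s2 : s ^+ 2 <= 1 by rewrite expr_le1.
have s20 := sqr_ge0 s.
have l1 : s ^+ 2 * x * y <= x by rewrite mulrAC ler_piMl // mulr_ile1.
have l2 : s ^+ 2 * x * y <= y by rewrite ler_piMl // mulr_ile1.
have l3 : s ^+ 2 * x * y <= s.
  by rewrite -mulrA expr2 -mulrA ler_piMr // mulr_ile1 ?mulr_ge0 // mulr_ile1.
by split; apply/eqP; rewrite eq_le ?s1 ?x1 ?y1 /=; apply: le_trans h _.
Qed.

Section BlockBound.
Variables (R : realType) (p n : nat).
Variables (U1 : 'M[R[i]]_p) (U2 : 'M[R[i]]_n) (A : 'M[R[i]]_(p, n)).
Variables (a : 'cV[R[i]]_p) (b : 'cV[R[i]]_n) (s g : R).
Hypotheses (U1u : U1 \is unitarymx) (U2u : U2 \is unitarymx).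
Hypotheses (aa : dot a a = 1) (bb : dot b b = 1).
Hypotheses (Ab : A *m b = s%:C *: a) (Aa : A ^t* *m a = s%:C *: b).
Hypotheses (s01 : 0 <= s <= 1) (g0s : 0 < g <= s ^+ 2).
Hypothesis gap : forall w, dot a w = 0 -> sqn (A ^t* *m w) <= (s ^+ 2 - g) * sqn w.

Let u1 := dot a (U1 *m a).
Let u2 := dot b (U2 *m b).
Let d := cmod (1 - (s ^+ 2)%:C * u1 * u2).
Let M : 'M[R[i]]_(p + n) := block_mx U1 A (A ^t*) U2.

Let s2_01 : 0 <= s ^+ 2 <= 1.
Proof. by case/andP: s01 => s0 s1; rewrite sqr_ge0 expr_le1. Qed.

Let u1_01 : 0 <= cmod u1 <= 1.
Proof. by rewrite cmod_ge0 cmod_overlap_le1. Qed.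

Let u2_01 : 0 <= cmod u2 <= 1.
Proof. by rewrite cmod_ge0 cmod_overlap_le1. Qed.

Let cmod_prod : cmod ((s ^+ 2)%:C * u1 * u2) = s ^+ 2 * cmod u1 * cmod u2.
Proof. by rewrite !cmodM cmod_real // sqr_ge0. Qed.

Let d_ge : 1 - s ^+ 2 * cmod u1 * cmod u2 <= d.
Proof.
have := cmodD (1 - (s ^+ 2)%:C * u1 * u2) ((s ^+ 2)%:C * u1 * u2).
by rewrite subrK cmod1 cmod_prod -lerBlDr.
Qed.

Let d_le2 : d <= 2.
Proof.
have /andP[s0 s1] := s2_01; have /andP[x0 x1] := u1_01; have /andP[y0 y1] := u2_01.
apply: le_trans (cmodB _ _) _; rewrite cmod1 cmod_prod lerD2l.
by apply: mulr_ile1 => //; [apply: mulr_ge0|apply: mulr_ile1].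
Qed.

Let d_conj : d = cmod (1 - (s ^+ 2)%:C * (u1^*)%R * (u2^*)%R).
Proof. by rewrite /d -[LHS]cmod_conj rmorphB rmorph1 !rmorphM /= conj_real. Qed.

Let gap_adj z : dot b z = 0 -> sqn (A *m z) <= (s ^+ 2 - g) * sqn z.
Proof.
move=> bz; apply: sqn_mul_adj; first by case/andP: g0s; rewrite subr_ge0.
exact/gap/(dot_mul_perp Aa).
Qed.

Lemma block_lower_bound x y :
  g * d * nrm (col_mx x y) <= 384 * nrm (M *m col_mx x y).
Proof.
have /andP[s0 s1] := s01; have /andP[g0 gs] := g0s; have /andP[_ s2] := s2_01.
rewrite mul_block_col; set f := U1 *m x + A *m y; set h := A ^t* *m x + U2 *m y.
have hE : U2 *m y + A ^t* *m x = h by rewrite addrC.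
have Ab' : A ^t* ^t* *m b = s%:C *: a by rewrite trmxCK.
set xi := dot a x; set eta := dot b y.
set x' := x - xi *: a; set y' := y - eta *: b.
have mul_le q k (B : 'M[R[i]]_(q, k)) z :
    sqn (B *m z) <= (s ^+ 2 - g) * sqn z -> nrm (B *m z) <= nrm z.
  move=> Bz; rewrite /nrm ler_wsqrtr // (le_trans Bz) // ler_piMl ?sqn_ge0 //.
  by rewrite lerBlDr (le_trans s2) // lerDl ltW.
set e := nrm (col_mx f h).
have fe : nrm f <= e by rewrite /e /nrm sqn_col_mx ler_wsqrtr // lerDl sqn_ge0.
have he : nrm h <= e by rewrite /e /nrm sqn_col_mx ler_wsqrtr // lerDr sqn_ge0.
pose r := Num.sqrt (2 * d).
pose E1 := xi + s%:C * eta * (u1^*)%R.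
pose E2 := eta + s%:C * xi * (u2^*)%R.
have E1le : cmod E1 <= e + r * nrm y'.
  apply: le_trans (cmod_half_system U1u aa bb Ab Aa x y) _; apply: lerD => //.
  apply: ler_pM; [exact: sqrtr_ge0|exact: nrm_ge0| |exact/mul_le/gap_adj/dot_residual].
  by rewrite ler_wsqrtr // (overlap_defect_le s2_01 u1_01 u2_01).
have E2le : cmod E2 <= e + r * nrm x'.
  apply: le_trans (cmod_half_system U2u bb aa Aa Ab' y x) _.
  apply: lerD; first by rewrite hE.
  apply: ler_pM; [exact: sqrtr_ge0|exact: nrm_ge0| |exact/mul_le/gap/dot_residual].
  by rewrite ler_wsqrtr // (overlap_defect_le s2_01 u2_01 u1_01) // mulrAC.
(* Eliminating the other unknown from the pair of equations E1, E2 costs a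
   factor s |v| <= 1 only. *)
have combine z F1 F2 v w w' : cmod v <= 1 ->
    z * (1 - (s ^+ 2)%:C * (u1^*)%R * (u2^*)%R) = F1 - s%:C * (v^*)%R * F2 ->
    cmod F1 <= e + r * w -> cmod F2 <= e + r * w' ->
    cmod z * d <= 2 * e + r * (w + w').
  move=> v1 zE F1le F2le; rewrite d_conj -cmodM zE (le_trans (cmodB _ _)) //.
  have -> : 2 * e + r * (w + w') = (e + r * w) + (e + r * w') by ring.
  apply: lerD => //; apply: le_trans F2le; rewrite !cmodM cmod_conj (cmod_real s0).
  by rewrite ler_piMl ?cmod_ge0 // mulr_ile1 ?cmod_ge0.
have xid : cmod xi * d <= 2 * e + r * (nrm x' + nrm y').
  rewrite [nrm x' + _]addrC; apply: (combine _ E1 E2 u1) => //.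
    by case/andP: u1_01.
  by rewrite /E1 /E2 rmorphXn /=; ring.
have etad : cmod eta * d <= 2 * e + r * (nrm x' + nrm y').
  apply: (combine _ E2 E1 u2) => //; first by case/andP: u2_01.
  by rewrite /E1 /E2 rmorphXn /=; ring.
have gapy := sqn_mul_gap aa bb Ab Aa y s01 gap_adj.
have gapx := sqn_mul_gap bb aa Aa Ab' x s01 gap.
have nx := nrm_half_system A U1u x y.
have ny := nrm_half_system (A ^t*) U2u y x; rewrite hE in ny.
apply: (@defect_estimate _ g d e (nrm (col_mx x y)) (nrm x) (nrm y) (nrm x') (nrm y')
  (cmod xi) (cmod eta) (nrm (A *m y)) (nrm (A ^t* *m x)) (nrm f) (nrm h) r);
  rewrite ?nrm_ge0 ?cmod_ge0 ?fe ?he ?sqr_nrm ?sqn_col_mx ?sqrtr_ge0 ?g0 ?d_le2 //.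
- exact: le_trans gs s2.
- exact: sqn_split.
- exact: sqn_split.
- by rewrite sqr_sqrtr // mulr_ge0 // cmod_ge0.
Qed.

Lemma block_singular : d = 0 -> M \notin unitmx.
Proof.
move=> d0.
have h : 1 <= s ^+ 2 * cmod u1 * cmod u2 by have := d_ge; rewrite d0 subr_le0.
have [sE e1 e2] := overlaps_eq1 s01 u1_01 u2_01 h.
have U1a := overlap1_eigenvector U1u aa e1; have U2b := overlap1_eigenvector U2u bb e2.
have /eqP : 1 - (s ^+ 2)%:C * u1 * u2 = 0 by apply/eqP; rewrite -cmod_eq0 -/d d0.
rewrite subr_eq0 sE expr1n mul1r => /eqP u12.
have kill : M *m col_mx a (- u1 *: b) = 0.
  rewrite mul_block_col -!scalemxAr Ab Aa U2b U1a sE !scale1r scalerA mulNr.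
  by rewrite -/u1 -/u2 -u12 scaleNr scaleN1r !subrr col_mx0.
apply/negP => Munit.
have /eqP := mulKmx Munit (col_mx a (- u1 *: b)).
rewrite kill mulmx0 eq_sym -sqn_eq0 sqn_col_mx (sqn_unit aa) gt_eqF //.
by rewrite ltr_wpDr ?sqn_ge0.
Qed.

End BlockBound.

(** * Perron-Frobenius for an eigenvalue equal to the operator norm *)

Section PerronFrobenius.
Variables (R : realType) (l : nat) (T : 'M[R[i]]_l) (lam : R).
Hypotheses (T0 : forall i j, 0 <= T i j) (irrT : irreducible_mx T).
Hypotheses (lam0 : 0 < lam) (Tlam : forall w, nrm (T *m w) <= lam * nrm w).

Implicit Types w : 'cV[R[i]]_l.

Definition absv (w : 'cV[R[i]]_l) : 'cV[R[i]]_l := \col_i (cmod (w i ord0))%:C.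

Lemma sqn_absv w : sqn (absv w) = sqn w.
Proof. by apply: eq_bigr => i _; rewrite mxE cmod_real ?cmod_ge0. Qed.

Lemma mul_absv w i : (T *m absv w) i ord0 = (\sum_j cmod (T i j) * cmod (w j ord0))%:C.
Proof.
rewrite mxE rmorph_sum; apply: eq_bigr => j _ /=.
by rewrite mxE rmorphM /= (cmod_id (T0 i j)).
Qed.

(** Entrywise T |w| >= |T w| = lam |w|, while the norm of T |w| is at most that
    of lam |w|; so no entry can be strictly larger. *)
Lemma eigen_absv w : T *m w = lam%:C *: w -> T *m absv w = lam%:C *: absv w.
Proof.
move=> Tw; pose t i := \sum_j cmod (T i j) * cmod (w j ord0).
have t_ge i : lam * cmod (w i ord0) <= t i.
  rewrite -[lam in leLHS](cmod_real (ltW lam0)) -cmodM.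
  have -> : lam%:C * w i ord0 = (T *m w) i ord0 by rewrite Tw mxE.
  rewrite mxE; apply: le_trans (cmod_sum _) _.
  by apply: ler_sum => j _; rewrite cmodM.
have lw i : 0 <= lam * cmod (w i ord0) by rewrite mulr_ge0 ?cmod_ge0 // ltW.
have diff0 i : 0 <= t i ^+ 2 - (lam * cmod (w i ord0)) ^+ 2.
  by rewrite subr_ge0 ler_pXn2r // nnegrE // (le_trans (lw i)).
have sum0 : \sum_i (t i ^+ 2 - (lam * cmod (w i ord0)) ^+ 2) = 0.
  apply/eqP; rewrite eq_le sumr_ge0 // andbT sumrB subr_le0.
  have : sqn (T *m absv w) <= lam ^+ 2 * sqn (absv w).
    rewrite -!sqr_nrm -exprMn ler_pXn2r // nnegrE ?nrm_ge0 //.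
    by rewrite mulr_ge0 ?nrm_ge0 // ltW.
  rewrite sqn_absv /sqn mulr_sumr.
  under eq_bigr => i _ do rewrite mul_absv cmod_real ?(le_trans (lw i) (t_ge i)) //.
  by under [leRHS]eq_bigr => i _ do rewrite -exprMn.
have tE i : t i = lam * cmod (w i ord0).
  have /(_ i isT)/eqP := psumr_eq0P (fun i _ => diff0 i) sum0.
  by rewrite subr_eq0 eqrXn2 ?(le_trans (lw i) (t_ge i)) // => /eqP.
apply/matrixP => i j; rewrite ord1 mul_absv -/(t i) tE !mxE.
by rewrite rmorphM.
Qed.

(** At an index where w vanishes, the eigenvector |w| expresses 0 as a sum of
    nonnegative terms, so irreducibility would spread the zero to all indices.
    As the entries of w may have any phase, this applies to linear combinations of
    eigenvectors. *)
Lemma eigen_neq0 w i : T *m w = lam%:C *: w -> w != 0 -> w i ord0 != 0.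
Proof.
move=> Tw w0; apply/negP => /eqP wi.
pose I := [set i | w i ord0 == 0].
have I0 : I != finset.set0 by apply/set0Pn; exists i; rewrite inE wi.
have IT : I != finset.setT.
  apply: contra w0 => /eqP IT; apply/eqP/matrixP => k j; rewrite ord1 mxE.
  by have : k \in I by [rewrite IT inE]; rewrite inE => /eqP.
have [k [j [kI jI Tkj]]] := irrT I0 IT.
move: kI jI; rewrite !inE => /eqP wk wj.
have /(congr1 (fun v : 'cV[R[i]]_l => v k ord0)) := eigen_absv Tw.
rewrite mul_absv !mxE wk cmod0 mulr0 => /complexI /psumr_eq0P => h.
have /eqP := h (fun j _ => mulr_ge0 (cmod_ge0 _) (cmod_ge0 _)) j isT.
by rewrite mulf_eq0 !cmod_eq0 (negbTE Tkj) (negbTE wj).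
Qed.

(** The combination of w and w' that vanishes at one index is zero. *)
Lemma eigen_simple w w' : T *m w = lam%:C *: w -> T *m w' = lam%:C *: w' ->
  w != 0 -> exists c, w' = c *: w.
Proof.
move=> Tw Tw' w0.
have [i|l0] := pickP 'I_l; last first.
  by case/eqP: w0; apply/matrixP => i; have := l0 i.
move=> _; have wi := eigen_neq0 i Tw w0.
exists (w' i ord0 / w i ord0); apply/eqP; rewrite -subr_eq0.
apply/negPn/negP => /(eigen_neq0 i _)/negP; apply.
  by rewrite mulmxBr -scalemxAr Tw Tw' scalerBr !scalerA mulrC.
by rewrite !mxE divfK // subrr.
Qed.

End PerronFrobenius.

(** * The operator norm *)

Section OperatorNorm.
Variable R : realType.

Lemma vnormE l (w : 'cV[R[i]]_l) : vnorm w = Num.sqrt (l%:R^-1) * nrm w.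
Proof. by rewrite /vnorm sqrtrM // invr_ge0. Qed.

Lemma vnormZ l c (w : 'cV[R[i]]_l) : vnorm (c *: w) = cmod c * vnorm w.
Proof. by rewrite !vnormE nrmZ mulrCA. Qed.

Lemma vnorm_ge0 l (w : 'cV[R[i]]_l) : 0 <= vnorm w.
Proof. exact: sqrtr_ge0. Qed.

Lemma opnorm_le l (T : 'M[R[i]]_l) K : 0 <= K ->
  (forall w, nrm (T *m w) <= K * nrm w) -> opnorm T <= K.
Proof.
move=> K0 TK; apply: ge_sup.
  by exists (vnorm (T *m 0)), 0; rewrite //= vnormE /nrm sqn0 sqrtr0 mulr0.
move=> _ [v /= v1 <-]; apply: le_trans (_ : K * vnorm v <= _).
  by rewrite !vnormE mulrCA ler_wpM2l ?sqrtr_ge0.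
by rewrite ler_piMr.
Qed.

Lemma opnorm_eigenvalue l (T : 'M[R[i]]_l) lam (z : 'cV_l) : 0 <= lam ->
  (forall w, nrm (T *m w) <= lam * nrm w) ->
  z != 0 -> T *m z = lam%:C *: z -> opnorm T = lam.
Proof.
move=> lam0 Tlam z0 Tz; apply/eqP; rewrite eq_le opnorm_le //=.
have vz : 0 < vnorm z.
  rewrite vnormE mulr_gt0 //; last by rewrite lt_def nrm_eq0 z0 nrm_ge0.
  rewrite sqrtr_gt0 invr_gt0 ltr0n lt0n; apply: contra z0 => /eqP l0.
  by apply/eqP/matrixP => i; have := ltn_ord i; rewrite {2}l0.
apply: ub_le_sup.
  exists lam => _ [v /= v1 <-]; apply: le_trans (_ : lam * vnorm v <= _).
    by rewrite !vnormE mulrCA ler_wpM2l ?sqrtr_ge0.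
  by rewrite ler_piMr.
exists ((vnorm z)^-1%:C *: z) => /=.
  by rewrite vnormZ cmod_real ?invr_ge0 ?vnorm_ge0 // mulVf ?gt_eqF.
rewrite -scalemxAr Tz scalerA vnormZ cmodM !cmod_real ?invr_ge0 ?vnorm_ge0 //.
by rewrite mulrAC mulVf ?gt_eqF // mul1r.
Qed.

End OperatorNorm.

(** * Spectral decomposition of a Gram matrix *)

Section Spectrum.
Variable R : realType.

Lemma mulmx_col m k l (A : 'M[R[i]]_(m, k)) (B : 'M_(k, l)) i :
  A *m col i B = col i (A *m B).
Proof. by rewrite !colE mulmxA. Qed.

(** Distinct indices, rather than the two values, are what turns a tie into two
    orthogonal eigenvectors.  A family with a single member has no second entry,
    and the default 0 of the sequence is read instead. *)
Lemma sort_top_two p (d : 'I_p -> R) : (0 < p)%N ->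
  let s := sort (fun x y => y <= x) [seq d i | i <- enum 'I_p] in
  exists i0, [/\ s`_0 = d i0, forall j, d j <= s`_0, forall j, j != i0 -> d j <= s`_1
    & (p = 1)%N /\ s`_1 = 0 \/ exists2 j0, j0 != i0 & s`_1 = d j0].
Proof.
move=> p0 s; pose leT := relpre d (fun x y => y <= x).
have tot : total leT by move=> i j; apply: le_total.
have trans : transitive leT by move=> i j k /= ij jk; apply: le_trans jk ij.
pose e := sort leT (enum 'I_p).
have sE : s = map d e by rewrite /s sort_map.
have sorted_e : sorted leT e by apply: sort_sorted.
have mem_e j : j \in e by rewrite mem_sort mem_enum.
have uniq_e : uniq e by rewrite sort_uniq enum_uniq.
have size_e : size e = p by rewrite size_sort size_enum_ord.
clearbody e; rewrite {}sE; case: e sorted_e mem_e uniq_e size_e => [|i0 t] /=.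
  by move=> _ _ _ E; rewrite -E in p0.
move=> pt mem_e /andP[i0t _] size_e.
exists i0; split=> //.
- move=> j; have := mem_e j; rewrite inE => /predU1P[->//|].
  by move/(allP (order_path_min trans pt)).
- move=> j ji0; have := mem_e j; rewrite inE (negbTE ji0) /=.
  case: t pt {mem_e i0t size_e} => [//|j0 t] /= /andP[_ pt].
  rewrite inE => /predU1P[->//|].
  by move/(allP (order_path_min trans pt)).
- case: t i0t size_e {pt mem_e} => [|j0 t] /=; first by left.
  rewrite inE negb_or eq_sym => /andP[ji0 _] _; by right; exists j0.
Qed.

Section Gram.
Variables (p n : nat) (B : 'M[R[i]]_(p, n)).
Let T : 'M[R[i]]_p := B *m B ^t*.
Let P := spectralmx T.

Lemma dot_gram x : dot x (T *m x) = (sqn (B ^t* *m x))%:C.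
Proof. by rewrite sqnE -mulmxA dot_adj. Qed.

Lemma gram_normal : T \is normalmx.
Proof. by apply/normalmxP; rewrite /T trmx_mul map_mxM trmxCK. Qed.

Definition eigvec i : 'cV[R[i]]_p := col i (P ^t*).
Definition eigval i : R := sqn (B ^t* *m eigvec i).

Lemma PPt : P *m P ^t* = 1%:M.
Proof. by apply/unitarymxP; apply: spectral_unitarymx. Qed.

Lemma gram_spectral : T = P ^t* *m diag_mx (spectral_diag T) *m P.
Proof.
by rewrite -(invmx_unitary (spectral_unitarymx T)); apply/orthomx_spectralP/gram_normal.
Qed.

Lemma dot_eigvec i x : dot (eigvec i) x = (P *m x) i ord0.
Proof.
rewrite dotE mxE; apply: eq_bigr => k _; by rewrite !mxE conjCK.
Qed.

Lemma eigvec_orthonormal i j : dot (eigvec i) (eigvec j) = (i == j)%:R.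
Proof. by rewrite dot_eigvec mulmx_col PPt !mxE. Qed.

Lemma mul_eigvec i : T *m eigvec i = spectral_diag T ord0 i *: eigvec i.
Proof.
rewrite /eigvec mulmx_col [in T *m _]gram_spectral -!mulmxA PPt mulmx1.
apply/matrixP => k j; rewrite mul_mx_diag !mxE mulrC; by [].
Qed.

Lemma spectral_diag_gram i : spectral_diag T ord0 i = (eigval i)%:C.
Proof.
by rewrite /eigval -dot_gram mul_eigvec dotZr eigvec_orthonormal eqxx mulr1.
Qed.

(** The diagonal of a Gram matrix in its eigenbasis is nonnegative. *)
Lemma absmx_gram : absmx T = T.
Proof.
have diagT : map_mx Num.norm (spectral_diag T) = spectral_diag T.
  apply/matrixP => i j; rewrite ord1 mxE spectral_diag_gram.
  by rewrite ger0_norm // ler0c sqn_ge0.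
by rewrite /absmx diagT invmx_unitary ?spectral_unitarymx // [RHS]gram_spectral.
Qed.

Lemma abs_eigenvalues_gram :
  abs_eigenvalues T = sort (fun x y => y <= x) [seq eigval i | i <- enum 'I_p].
Proof.
rewrite /abs_eigenvalues absmx_gram; congr (sort _ _).
by apply: eq_map => i; rewrite spectral_diag_gram.
Qed.

Lemma sqn_spectral x :
  sqn (B ^t* *m x) = \sum_i eigval i * cmod (dot (eigvec i) x) ^+ 2.
Proof.
apply: complexI; rewrite -dot_gram {1}gram_spectral -!mulmxA dot_adj trmxCK dotE.
rewrite rmorph_sum; apply: eq_bigr => i _.
by rewrite mul_diag_mx !mxE spectral_diag_gram rmorphM /= sqr_cmod dot_eigvec mxE
  mulrCA.
Qed.

Lemma parseval x : sqn x = \sum_i cmod (dot (eigvec i) x) ^+ 2.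
Proof.
rewrite -(sqn_unitary x (spectral_unitarymx T)).
by apply: eq_bigr => i _; rewrite dot_eigvec.
Qed.

(** The second eigenvalue lam - Gap T comes with an eigenvector orthogonal to the
    first one, unless p = 1, where it is 0.  Both cases matter for showing that
    the gap is positive. *)
Lemma gram_top : (0 < p)%N ->
  let lam := (abs_eigenvalues T)`_0 in
  exists w, [/\ dot w w = 1, T *m w = lam%:C *: w,
    forall x, sqn (B ^t* *m x) <= lam * sqn x,
    forall x, dot w x = 0 -> sqn (B ^t* *m x) <= (lam - Gap T) * sqn x
   & 0 <= lam - Gap T /\
     (lam - Gap T = 0 \/
      exists w', [/\ dot w' w' = 1, dot w w' = 0 & T *m w' = (lam - Gap T)%:C *: w'])].
Proof.
move=> p0 lam.
have -> : lam - Gap T = (abs_eigenvalues T)`_1 by rewrite /Gap subKr.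
rewrite /lam abs_eigenvalues_gram.
have [i0 [s0 ge_s0 ge_s1 s1]] := sort_top_two eigval p0.
exists (eigvec i0); split.
- by rewrite eigvec_orthonormal eqxx.
- by rewrite mul_eigvec spectral_diag_gram s0.
- move=> x; rewrite sqn_spectral parseval mulr_sumr.
  by apply: ler_sum => i _; rewrite ler_wpM2r // sqr_ge0.
- move=> x wx; rewrite sqn_spectral parseval mulr_sumr.
  apply: ler_sum => i _; have [->|ii0] := eqVneq i i0.
    by rewrite wx cmod0 expr0n !mulr0.
  by rewrite ler_wpM2r ?sqr_ge0 // ge_s1.
- case: s1 => [[_ ->]|[j0 j0i0 ->]]; first by split; [|left].
  split; first exact: sqn_ge0.
  right; exists (eigvec j0); rewrite !eigvec_orthonormal eqxx eq_sym (negbTE j0i0).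
  by rewrite mul_eigvec spectral_diag_gram.
Qed.

End Gram.
End Spectrum.

(** * The positive singular vectors of A *)

Section Assembly.
Variable R : realType.

Lemma pos_eigenvector_unique l (T : 'M[R[i]]_l) lam v :
  (forall i j, 0 <= T i j) -> irreducible_mx T -> 0 < lam ->
  (forall w, nrm (T *m w) <= lam * nrm w) ->
  pos_normalized_eigenvector T lam v ->
  unique (pos_normalized_eigenvector T lam) v.
Proof.
move=> T0 irrT lam0 Tlam vP; split=> // v' [v'_pos v'1 Tv'].
have [v_pos v1 Tv] := vP.
have v0 : v != 0.
  apply: contraTneq (@ltr01 R) => vE.
  by rewrite -v1 vE vnormE /nrm sqn0 sqrtr0 mulr0 ltxx.
have [c v'E] := eigen_simple T0 irrT lam0 Tlam Tv Tv' v0.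
have [i _|l0] := pickP 'I_l; last first.
  by case/eqP: v0; apply/matrixP => i; have := l0 i.
have c0 : 0 < c by have := v'_pos i; rewrite v'E mxE pmulr_lgt0.
rewrite v'E in v'1 *; rewrite vnormZ v1 mulr1 in v'1.
by rewrite -(cmod_id (ltW c0)) v'1 scale1r.
Qed.

Lemma innerE l (v w : 'cV[R[i]]_l) : inner v w = l%:R^-1 * dot v w.
Proof. by rewrite dotE; congr (_ * _). Qed.

Section Rescale.
Variables (l : nat) (a : 'cV[R[i]]_l).
Hypothesis aa : dot a a = 1.

Let l_gt0 : (0 < l)%N.
Proof.
rewrite lt0n; apply/negP => /eqP l0; have /eqP := sqn_unit aa; rewrite /sqn big1.
  by rewrite eq_sym oner_eq0.
by move=> i; have := ltn_ord i; rewrite {2}l0.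
Qed.

Lemma pos_normalized_rescale (T : 'M[R[i]]_l) lam :
  (forall i, 0 < a i ord0) -> T *m a = lam%:C *: a ->
  pos_normalized_eigenvector T lam ((Num.sqrt l%:R)%:C *: a).
Proof.
move=> a0 Ta; split.
- by move=> i; rewrite mxE mulr_gt0 // ltcR sqrtr_gt0 ltr0n.
- rewrite vnormZ cmod_real ?sqrtr_ge0 // vnormE nrm_unit // mulr1 -sqrtrM ?ler0n //.
  by rewrite mulfV ?sqrtr1 // pnatr_eq0 -lt0n.
- by rewrite -scalemxAr Ta !scalerA mulrC.
Qed.

Lemma inner_rescale (U : 'M[R[i]]_l) :
  inner ((Num.sqrt l%:R)%:C *: a) (U *m ((Num.sqrt l%:R)%:C *: a)) = dot a (U *m a).
Proof.
rewrite innerE -scalemxAr dotZl dotZr conj_real !mulrA -[_^-1 * _ * _]mulrA -rmorphM /=.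
rewrite -expr2 sqr_sqrtr ?ler0n // rmorph_nat mulVf ?mul1r //.
by rewrite pnatr_eq0 -lt0n.
Qed.

End Rescale.

Lemma unitmx_inj l (M : 'M[R[i]]_l) :
  (forall z : 'cV_l, M *m z = 0 -> z = 0) -> M \in unitmx.
Proof.
move=> Minj; rewrite -unitmx_tr -row_free_unit -kermx_eq0; apply/eqP/row_matrixP => i.
rewrite row0; apply: trmx_inj; rewrite trmx0; apply: Minj.
by apply: trmx_inj; rewrite trmx_mul trmxK trmx0 -row_mul mulmx_ker row0.
Qed.

Lemma inv_opnorm_le l (M : 'M[R[i]]_l) k : 0 < k ->
  (forall z, k * nrm z <= nrm (M *m z)) ->
  M \in unitmx /\ opnorm (invmx M) <= k^-1.
Proof.
move=> k0 Mk; have Mu : M \in unitmx.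
  apply: unitmx_inj => z Mz; apply/eqP; rewrite -nrm_eq0 eq_le nrm_ge0 andbT.
  by rewrite -(ler_pM2l k0) mulr0 (le_trans (Mk z)) // Mz /nrm sqn0 sqrtr0.
split=> //; apply: opnorm_le; first by rewrite invr_ge0 ltW.
by move=> w; rewrite ler_pdivlMl // (le_trans (Mk _)) // mulKVmx.
Qed.

Section SingularPair.
Variables (p n : nat) (B : 'M[R[i]]_(p, n)).

Lemma gram_bound K : 0 <= K -> (forall x, sqn (B ^t* *m x) <= K * sqn x) ->
  forall y, sqn (B *m y) <= K * sqn y.
Proof. by move=> K0 BK y; apply: sqn_mul_adj. Qed.

Lemma nrm_gram_le K : 0 <= K -> (forall x, sqn (B ^t* *m x) <= K * sqn x) ->
  (forall x, nrm (B *m B ^t* *m x) <= K * nrm x) /\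
  (forall y, nrm (B ^t* *m B *m y) <= K * nrm y).
Proof.
move=> K0 BK; have BK' := gram_bound K0 BK.
split=> z; rewrite -mulmxA -(@ler_pXn2r _ 2) ?nnegrE ?mulr_ge0 ?nrm_ge0 //;
  rewrite exprMn !sqr_nrm [K ^+ 2]expr2 -mulrA.
  by apply: le_trans (BK' _) _; apply: ler_wpM2l.
by apply: le_trans (BK _) _; apply: ler_wpM2l.
Qed.

End SingularPair.

Section TopPair.
Variables (p n : nat) (A : 'M[R]_(p, n)).
Let B : 'M[R[i]]_(p, n) := map_mx (real_complex R) A.
Let lam := opnorm (B ^t* *m B).
Let s := Num.sqrt lam.
Hypotheses (A0 : forall i j, 0 <= A i j) (lam0 : 0 < lam).
Hypotheses (irr2 : irreducible_mx (B ^t* *m B)) (irr1 : irreducible_mx (B *m B ^t*)).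

Let B0 i j : 0 <= B i j.
Proof. by rewrite mxE ler0c. Qed.

Let Bt0 i j : 0 <= B ^t* i j.
Proof. by rewrite !mxE conj_real ler0c. Qed.

Lemma rows_gt0 : (0 < p)%N.
Proof.
rewrite lt0n; apply/negP => /eqP p0.
have : lam <= 0.
  apply: opnorm_le => // w; rewrite mul0r -mulmxA.
  have -> : B *m w = 0 by apply/matrixP => i; have := ltn_ord i; rewrite {2}p0.
  by rewrite mulmx0 /nrm sqn0 sqrtr0.
by rewrite leNgt lam0.
Qed.

(** The absolute value of a top eigenvector w of B B^* is positive, and its image
    under B^* is then the positive top eigenvector of B^* B.  A vanishing gap would
    give a second top eigenvector orthogonal to w, against simplicity. *)
Lemma top_pair : exists a b,
  [/\ dot a a = 1 /\ dot b b = 1,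
      B *m b = s%:C *: a /\ B ^t* *m a = s%:C *: b,
      unique (pos_normalized_eigenvector (B *m B ^t*) lam) ((Num.sqrt p%:R)%:C *: a),
      unique (pos_normalized_eigenvector (B ^t* *m B) lam) ((Num.sqrt n%:R)%:C *: b)
    & 0 < Gap (B *m B ^t*) <= lam /\
      forall w, dot a w = 0 -> sqn (B ^t* *m w) <= (lam - Gap (B *m B ^t*)) * sqn w].
Proof.
have [w []] := gram_top B rows_gt0.
set T := B *m B ^t*; set S := B ^t* *m B; set mu := _`_0; set g := Gap T.
move=> ww Tw Bmu Bgap [gmu second].
have mu0 : 0 <= mu.
  by rewrite -[mu]mulr1 -(sqn_unit ww) (le_trans (sqn_ge0 _) (Bmu w)).
have [Tmu Smu] := nrm_gram_le mu0 Bmu.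
have lam_mu : lam <= mu by apply: opnorm_le.
have mu_gt0 : 0 < mu by apply: lt_le_trans lam0 lam_mu.
have lamE : lam = mu.
  apply: (@opnorm_eigenvalue _ _ _ mu (B ^t* *m w)) => //.
    rewrite -sqn_eq0 gt_eqF //; suff -> : sqn (B ^t* *m w) = mu by [].
    by apply: complexI; rewrite -dot_gram -/T Tw dotZr ww mulr1.
  by rewrite -mulmxA [B *m _]mulmxA -/T Tw scalemxAr.
have T0 : forall i j, 0 <= T i j by apply: mulmx_ge0.
have S0 : forall i j, 0 <= S i j by apply: mulmx_ge0.
have w0 : w != 0 by rewrite -sqn_eq0 (sqn_unit ww) oner_eq0.
pose a := absv w.
have aa : dot a a = 1 by rewrite -sqnE sqn_absv (sqn_unit ww).
have Ta : T *m a = mu%:C *: a by apply: eigen_absv.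
have a_gt0 i : 0 < a i ord0.
  by rewrite mxE ltcR lt_def cmod_ge0 cmod_eq0 (eigen_neq0 T0 irr1 mu_gt0 Tmu).
have s_gt0 : 0 < s by rewrite sqrtr_gt0.
have sC0 : s%:C != 0 :> R[i] by rewrite (inj_eq (@complexI R) s 0) gt_eqF.
have s2 : s%:C * s%:C = mu%:C :> R[i].
  by rewrite -rmorphM -expr2 sqr_sqrtr ?lamE.
pose b := s^-1%:C *: (B ^t* *m a).
have Ba : B ^t* *m a = s%:C *: b.
  by rewrite scalerA -rmorphM mulfV ?scale1r // gt_eqF.
have Bb : B *m b = s%:C *: a.
  by apply: (scalerI sC0); rewrite scalemxAr -Ba mulmxA -/T Ta scalerA s2.
have Sb : S *m b = mu%:C *: b by rewrite -mulmxA Bb -scalemxAr Ba scalerA s2.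
have bb : dot b b = 1.
  by apply: (mulfI sC0); rewrite -dotZr -Ba dot_adj trmxCK Bb dotZl aa conj_real.
have b0 : b != 0 by rewrite -sqn_eq0 (sqn_unit bb) oner_eq0.
have b_gt0 i : 0 < b i ord0.
  rewrite lt_def (eigen_neq0 S0 irr2 mu_gt0 Smu) //= mxE mulr_ge0 //.
    by rewrite ler0c invr_ge0 ltW.
  by apply: mulmx_ge0 => // k j; rewrite ord1 ltW.
exists a, b; rewrite lamE; split; [by split|by split| | |].
- apply: pos_eigenvector_unique T0 irr1 mu_gt0 Tmu _.
  exact: pos_normalized_rescale aa _ _ a_gt0 Ta.
- apply: pos_eigenvector_unique S0 irr2 mu_gt0 Smu _.
  exact: pos_normalized_rescale bb _ _ b_gt0 Sb.
split; last first.
  have a0 : a != 0 by rewrite -sqn_eq0 (sqn_unit aa) oner_eq0.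
  have [c wE] := eigen_simple T0 irr1 mu_gt0 Tmu Ta Tw a0.
  by move=> x ax; apply: Bgap; rewrite wE dotZl ax mulr0.
rewrite -subr_ge0 gmu andbT.
case: second => [|[w' [w'w' ww' Tw']]]; first by move/subr0_eq <-.
rewrite lt_def; apply/andP; split; last first.
  have := Bmu w'; rewrite (sqn_unit w'w') mulr1.
  suff -> : sqn (B ^t* *m w') = mu - g by rewrite gerBl.
  by apply: complexI; rewrite -dot_gram -/T Tw' dotZr w'w' mulr1.
apply/eqP => g0; rewrite g0 subr0 in Tw'.
have [c w'E] := eigen_simple T0 irr1 mu_gt0 Tmu Tw Tw' w0.
move: ww' w'w'; rewrite w'E dotZr ww mulr1 => ->; rewrite scale0r /dot mulmx0 mxE.
by move/eqP; rewrite eq_sym oner_eq0.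
Qed.

End TopPair.
End Assembly.

(** * The bound *)

Theorem lemma3p6 (R : realType) :
  exists C : R, 0 < C /\
  forall (n p : nat) (U1 : 'M[R[i]]_p) (U2 : 'M[R[i]]_n) (A : 'M[R]_(p, n)),
    let Ac : 'M[R[i]]_(p, n) := map_mx (real_complex R) A in
    let AAs : 'M[R[i]]_p := Ac *m Ac ^t* in
    let AsA : 'M[R[i]]_n := Ac ^t* *m Ac in
    U1 \is unitarymx -> U2 \is unitarymx ->
    (forall i j, 0 <= A i j) ->
    irreducible_mx AsA -> irreducible_mx AAs ->
    0 < opnorm AsA <= 1 ->
    exists (v1 : 'cV[R[i]]_p) (v2 : 'cV[R[i]]_n),
      unique (pos_normalized_eigenvector AAs (opnorm AsA)) v1 /\
      unique (pos_normalized_eigenvector AsA (opnorm AsA)) v2 /\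
      let M : 'M[R[i]]_(p + n) := block_mx U1 Ac (Ac ^t*) U2 in
      let rhs : \bar R :=
        (C%:E / (Gap AAs * cmod (1 - (opnorm AsA)%:C * inner v1 (U1 *m v1)
                                     * inner v2 (U2 *m v2)))%:E)%E in
      [/\ (inv_opnorm M <= rhs)%E,
          inv_opnorm M = +oo%E <-> rhs = +oo%E
        & rhs = +oo%E <-> ~ exists N : 'M[R[i]]_(p + n), N *m M = 1%:M /\ M *m N = 1%:M].
Proof.
exists 384; split=> // n p U1 U2 A Ac AAs AsA U1u U2u A0 irr2 irr1 /andP[lam0 lam1].
have [a [b [[aa bb] [Ab Aa] v1P v2P [/andP[g0 gs] gap]]]] := top_pair A0 lam0 irr2 irr1.
exists ((Num.sqrt p%:R)%:C *: a), ((Num.sqrt n%:R)%:C *: b); split=> //; split=> //.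
move=> M rhs.
have s01 : 0 <= Num.sqrt (opnorm AsA) <= 1.
  by rewrite sqrtr_ge0 -[leRHS]sqrtr1 ler_wsqrtr.
have lamE : opnorm AsA = Num.sqrt (opnorm AsA) ^+ 2 by rewrite sqr_sqrtr // ltW.
have g0s : 0 < Gap AAs <= Num.sqrt (opnorm AsA) ^+ 2 by rewrite -lamE g0.
rewrite {1}lamE in gap.
have lower := block_lower_bound U1u U2u aa bb Ab Aa s01 g0s gap.
have singular := block_singular U1u U2u aa bb Ab Aa s01.
rewrite -lamE in lower singular.
have unitP : (exists N : 'M[R[i]]_(p + n), N *m M = 1%:M /\ M *m N = 1%:M) <-> M \in unitmx.
  split=> [[N [_ MN]]|Mu]; first by have [] := mulmx1_unit MN.
  by exists (invmx M); rewrite mulVmx ?mulmxV.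
have inv_ooP : inv_opnorm M = +oo%E <-> M \notin unitmx.
  by rewrite /inv_opnorm; case: (M \in unitmx).
have rhsE : rhs = (384%:E / (Gap AAs * cmod (1 - (opnorm AsA)%:C * dot a (U1 *m a)
    * dot b (U2 *m b)))%:E)%E by rewrite /rhs !inner_rescale.
move: rhsE lower singular; set d := cmod _ => rhsE lower singular.
have d0 : 0 <= d by apply: cmod_ge0.
suff [le_rhs rhs_oo] : (inv_opnorm M <= rhs)%E /\ (rhs = +oo%E <-> M \notin unitmx).
  split=> //; first by rewrite inv_ooP rhs_oo.
  by rewrite rhs_oo unitP; split=> [/negP|/negP].
have [dE|d_neq0] := eqVneq d 0.
  have -> : rhs = +oo%E by rewrite rhsE dE mulr0 inve0 gt0_muley // lte_fin.
  by rewrite leey; split=> //; split=> // _; apply: singular.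
have gd0 : 0 < Gap AAs * d by rewrite mulr_gt0 // lt_def d_neq0.
have [Mu Minv] : M \in unitmx /\ opnorm (invmx M) <= (Gap AAs * d / 384)^-1.
  apply: inv_opnorm_le => [|z]; first by rewrite divr_gt0.
  rewrite mulrAC ler_pdivrMr // [leRHS]mulrC -[z]vsubmxK; exact: lower.
rewrite rhsE inver gt_eqF // -EFinM; split; last by rewrite Mu.
by rewrite /inv_opnorm Mu lee_fin (le_trans Minv) // invf_div.
Qed.
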